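(* Let $d\ge 1$ and $q>2$ be integers. Then the fundamental group of the Hamming graph $H(d,q)$ satisfies $\Pi(H(d,3))\cong\mathbb{Z}^d$, and $\Pi(H(d,q))\cong\mathbb{Z}_2^d$ when $q\neq 3$ (i.e. when $q>3$).
   Context: The Hamming graph $H(d,q)$ has vertex set $\{(x_1,\ldots,x_d): x_i\in S\}$ with $S=\{0,1,\ldots,q-1\}$, and two vertices are adjacent if and only if they differ in exactly one coordinate; $\mathbf{0}=(0,\ldots,0)$. A walk of length $n$ in a graph is a sequence of vertices $(v_0v_1\cdots v_n)$ with $v_i$ adjacent to $v_{i+1}$ for all $0\le i<n$. Two walks are equivalent, written $\simeq$ (homotopic rel endpoints for $\times$-homotopy), if one can be transformed into the other by a finite sequence of the following moves: (1) spider moves: replacing a single interior vertex $v_k$ ($0<k<n$) of a walk by another vertex $v_k'$ such that the result is again a walk (so $v_k'$ is adjacent to both $v_{k-1}$ and $v_{k+1}$); (2) prunes: if $v_i=v_{i+2}$, deleting the entries $v_i,v_{i+1}$ from the walk; (3) anti-prunes: the inverse operation of a prune. For a connected graph $G$ and a vertex $v$ of $G$, the fundamental group $\Pi(G)$ is the set of equivalence classes of closed walks starting and ending at $v$, with concatenation as operation; for Hamming graphs the base vertex is $\mathbf{0}$. $\mathbb{Z}_2$ denotes the cyclic group of order $2$. *)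

(* Defs.v *)
From Stdlib Require Import Relation_Operators.
From HB Require Import structures.
From mathcomp Require Import all_boot all_order all_algebra.
From mathcomp Require Import boolp.

Set Implicit Arguments.
Unset Strict Implicit.
Unset Printing Implicit Defensive.

Local Open Scope quotient_scope.

Record graph := Graph {
  vertex :> choiceType;
  adj : rel vertex;
  adj_sym : symmetric adj;
  adj_irr : irreflexive adj }.

Section Walks.
Variable G : graph.
Implicit Types (v a b c : G) (w s t : seq G).

Definition is_walk w := (w != [::]) && sorted (@adj G) w.

Inductive move : seq G -> seq G -> Prop :=
| Spider s a b b' c t :
    is_walk (s ++ [:: a, b, c & t]) -> is_walk (s ++ [:: a, b', c & t]) ->
    move (s ++ [:: a, b, c & t]) (s ++ [:: a, b', c & t])
| Prune s a b t :
    is_walk (s ++ [:: a, b, a & t]) ->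
    move (s ++ [:: a, b, a & t]) (s ++ a :: t)
| AntiPrune s a b t :
    is_walk (s ++ [:: a, b, a & t]) ->
    move (s ++ a :: t) (s ++ [:: a, b, a & t]).

Definition homotopic : seq G -> seq G -> Prop := clos_refl_trans (seq G) move.

Lemma move_sym w w' : move w w' -> move w' w.
Proof. by case=> *; constructor. Qed.

Lemma homotopic_sym w w' : homotopic w w' -> homotopic w' w.
Proof.
elim=> [x y /move_sym xy|x|x y z _ yx _ zy]; first exact: rt_step.
- exact: rt_refl.
- exact: rt_trans zy yx.
Qed.

Lemma is_walk_cat_cons s a t :
  is_walk (s ++ a :: t) = sorted (@adj G) (rcons s a) && path (@adj G) a t.
Proof.
case: s => [|x s] //; rewrite /is_walk /=.
by rewrite cat_path rcons_path /= andbA.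
Qed.

Lemma move_walkE w w' s t : move w w' ->
  is_walk (s ++ w ++ t) = is_walk (s ++ w' ++ t).
Proof.
case=> [s' a b b' c t'|s' a b t'|s' a b t'] /=;
  rewrite -!catA !cat_cons !(catA s s') !is_walk_cat_cons /=.
- by case/and4P=> _ -> -> _ /and4P[_ -> -> _].
- by case/and4P=> _ -> -> _.
- by case/and4P=> _ -> -> _.
Qed.

Lemma move_cat w w' s t : is_walk (s ++ w ++ t) ->
  move w w' -> move (s ++ w ++ t) (s ++ w' ++ t).
Proof.
move=> ww mv; have ww' := ww; rewrite (move_walkE _ _ mv) in ww'.
case: mv ww ww' => [s' a b b' c t' _ _|s' a b t' _|s' a b t' _];
  rewrite -!catA !cat_cons !(catA s s') => h h'; by constructor.
Qed.

Lemma homotopic_cat w w' s t : is_walk (s ++ w ++ t) ->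
  homotopic w w' -> homotopic (s ++ w ++ t) (s ++ w' ++ t).
Proof.
move=> h ww'; suff [] : homotopic (s ++ w ++ t) (s ++ w' ++ t) /\
  is_walk (s ++ w' ++ t) by [].
elim: ww' h => [x y xy h|x h|x y z _ IHx _ IHy h].
- by split; [exact/rt_step/move_cat|rewrite -(move_walkE _ _ xy)].
- by split; first exact: rt_refl.
- have [xy hy] := IHx h; have [yz hz] := IHy hy.
  by split=> //; exact: rt_trans xy yz.
Qed.

End Walks.

(* [steps] lists all the vertices but the first: the closed walk itself is
   [v :: steps]. *)
Record closed_walk (G : graph) (v : G) := ClosedWalk {
  steps : seq G;
  stepsP : path (@adj G) v steps && (last v steps == v) }.

HB.instance Definition _ (G : graph) (v : G) := [isSub for @steps G v].
HB.instance Definition _ (G : graph) (v : G) :=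
  [Choice of closed_walk v by <:].

Section FundamentalGroup.
Variables (G : graph) (v : G).
Implicit Types p q r : closed_walk v.

Definition cw_equiv p q : bool := `[< homotopic (v :: steps p) (v :: steps q) >].

Lemma cw_equivP p q :
  reflect (homotopic (v :: steps p) (v :: steps q)) (cw_equiv p q).
Proof. exact: asboolP. Qed.

Lemma cw_equiv_refl : reflexive cw_equiv.
Proof. by move=> p; apply/cw_equivP; exact: rt_refl. Qed.

Lemma cw_equiv_sym : symmetric cw_equiv.
Proof. by move=> p q; apply/cw_equivP/cw_equivP; apply: homotopic_sym. Qed.

Lemma cw_equiv_trans : transitive cw_equiv.
Proof.
move=> q p r /cw_equivP pq /cw_equivP qr.
by apply/cw_equivP; exact: rt_trans pq qr.
Qed.

Canonical cw_equiv_rel :=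
  EquivRel cw_equiv cw_equiv_refl cw_equiv_sym cw_equiv_trans.

Definition fundamental_group := {eq_quot cw_equiv}.

HB.instance Definition _ : EqQuotient _ cw_equiv fundamental_group :=
  EqQuotient.on fundamental_group.
HB.instance Definition _ := Choice.on fundamental_group.

Definition cw_const : closed_walk v := @ClosedWalk G v [::] (eqxx v).

Lemma cw_cat_subproof p q :
  path (@adj G) v (steps p ++ steps q) && (last v (steps p ++ steps q) == v).
Proof.
case/andP: (stepsP p) => pp /eqP lp; case/andP: (stepsP q) => pq lq.
by rewrite cat_path last_cat lp pp pq.
Qed.

Definition cw_cat p q : closed_walk v := ClosedWalk (cw_cat_subproof p q).

Lemma cw_rev_subproof p :
  path (@adj G) v (rev (belast v (steps p))) &&
  (last v (rev (belast v (steps p))) == v).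
Proof.
case: p => p /= /andP[pp /eqP lp]; apply/andP; split.
  have := rev_path (@adj G) v p; rewrite lp => ->.
  by rewrite (eq_path (e' := @adj G)) // => x y; rewrite adj_sym.
by case: p {pp} lp => //= x p _; rewrite rev_cons last_rcons.
Qed.

Definition cw_rev p : closed_walk v := ClosedWalk (cw_rev_subproof p).

Lemma closed_is_walk p : is_walk (v :: steps p).
Proof. by case/andP: (stepsP p). Qed.

Lemma cw_cat_equiv p p' q q' :
  cw_equiv p p' -> cw_equiv q q' -> cw_equiv (cw_cat p q) (cw_cat p' q').
Proof.
move=> /cw_equivP pp' /cw_equivP qq'; apply/cw_equivP => /=.
apply: (rt_trans _ _ _ (v :: steps p' ++ steps q)).
  apply: (@homotopic_cat G _ _ [::] (steps q)) pp' => /=.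
  exact: (closed_is_walk (cw_cat p q)).
have catE (u : seq G) : v :: steps p' ++ u = belast v (steps p') ++ (v :: u).
  case/andP: (stepsP p') => _ /eqP lp.
  by rewrite -cat_cons lastI lp cat_rcons.
rewrite !catE -[v :: steps q]cats0 -[v :: steps q']cats0.
apply: homotopic_cat qq'; rewrite cats0 -catE.
exact: (closed_is_walk (cw_cat p' q)).
Qed.

Lemma homotopic_rev (a : G) (s : seq G) : path (@adj G) a s ->
  homotopic (a :: s ++ rev (belast a s)) [:: a].
Proof.
elim: s a => [|b s IHs] a /=; first by move=> _; exact: rt_refl.
case/andP=> ab bs; have := IHs _ bs => h.
rewrite rev_cons -cats1.
apply: (rt_trans _ _ _ [:: a; b; a]); last first.
  by apply/rt_step/(@Prune G [::] a b [::]); rewrite /is_walk /= ab adj_sym ab.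
rewrite catA.
have -> : a :: (b :: s ++ rev (belast b s)) ++ [:: a] =
    [:: a] ++ (b :: s ++ rev (belast b s)) ++ [:: a] by [].
have -> : [:: a; b; a] = [:: a] ++ [:: b] ++ [:: a] by [].
apply: homotopic_cat h => /=.
rewrite /is_walk /= ab cats1 rcons_path cat_path bs /=.
have -> : path (@adj G) (last b s) (rev (belast b s)).
  by rewrite rev_path (eq_path (e' := @adj G)) // => x y; rewrite adj_sym.
rewrite last_cat; case: s {IHs bs} => [|c s] /=; first by rewrite adj_sym.
by rewrite rev_cons last_rcons adj_sym.
Qed.

Lemma cw_catV p : cw_equiv (cw_cat p (cw_rev p)) cw_const.
Proof.
by apply/cw_equivP => /=; apply: homotopic_rev; case/andP: (stepsP p).
Qed.

Lemma cw_revK : involutive cw_rev.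
Proof.
case=> p hp; apply: val_inj; rewrite /= .
case/andP: hp => _ /eqP; case/lastP: p => [//|p x]; rewrite last_rcons => ->.
by rewrite belast_rcons rev_cons belast_rcons rev_cons revK.
Qed.

Lemma cw_Vcat p : cw_equiv (cw_cat (cw_rev p) p) cw_const.
Proof. by rewrite -{2}[p]cw_revK cw_catV. Qed.

Definition fg_one : fundamental_group := \pi_fundamental_group cw_const.
Definition fg_mul (x y : fundamental_group) : fundamental_group :=
  \pi_fundamental_group (cw_cat (repr x) (repr y)).
Definition fg_inv (x : fundamental_group) : fundamental_group :=
  \pi_fundamental_group (cw_rev (repr x)).

Lemma fg_mulE p q :
  fg_mul (\pi_fundamental_group p)
    (\pi_fundamental_group q) = \pi_fundamental_group (cw_cat p q).
Proof.
apply/eqmodP; apply: cw_cat_equiv.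
  by apply/eqmodP; rewrite reprK.
by apply/eqmodP; rewrite reprK.
Qed.

Lemma fg_mulA : associative fg_mul.
Proof.
elim/quotW=> p; elim/quotW=> q; elim/quotW=> r.
rewrite (fg_mulE q r) (fg_mulE p (cw_cat q r)).
rewrite (fg_mulE p q) (fg_mulE (cw_cat p q) r).
by apply: congr1; apply: val_inj; rewrite /= catA.
Qed.

Lemma fg_mul1 : left_id fg_one fg_mul.
Proof.
elim/quotW=> p; rewrite fg_mulE.
by apply: congr1; apply: val_inj.
Qed.

Lemma fg_mulr1 : right_id fg_one fg_mul.
Proof.
elim/quotW=> p; rewrite fg_mulE.
by apply: congr1; apply: val_inj; rewrite /= cats0.
Qed.

Lemma fg_mulV : left_inverse fg_one fg_inv fg_mul.
Proof.
move=> x; rewrite -{2}[x]reprK fg_mulE.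
by apply/eqmodP; exact: cw_Vcat.
Qed.

Lemma fg_mulrV : right_inverse fg_one fg_inv fg_mul.
Proof.
move=> x; rewrite -{1}[x]reprK fg_mulE.
by apply/eqmodP; exact: cw_catV.
Qed.

HB.instance Definition _ := isGroup.Build fundamental_group
  fg_mulA fg_mul1 fg_mulr1 fg_mulV fg_mulrV.

End FundamentalGroup.

Section Hamming.
Variables d q : nat.
Implicit Types x y : {ffun 'I_d -> 'I_q}.

Definition hamming_adj x y := #|[set i | x i != y i]| == 1.

Lemma hamming_adj_sym : symmetric hamming_adj.
Proof.
by move=> x y; rewrite /hamming_adj; under eq_finset do rewrite eq_sym.
Qed.

Lemma hamming_adj_irr : irreflexive hamming_adj.
Proof.
by move=> x; rewrite /hamming_adj; under eq_finset do rewrite eqxx; rewrite cards0.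
Qed.

Definition hamming : graph := Graph hamming_adj_sym hamming_adj_irr.

Definition hamming0 (q_gt0 : 0 < q) : hamming := [ffun=> Ordinal q_gt0].

End Hamming.

(* Isomorphism between a group written multiplicatively and an abelian group
   written additively. *)
Definition group_iso (G : groupType) (A : zmodType) : Prop :=
  exists f : G -> A, bijective f /\ {morph f : x y / (x * y)%g >-> (x + y)%R}.

(* Main.v *)
Require Import Defs.
From mathcomp Require Import all_boot all_order all_algebra.
From Stdlib Require Import Relation_Operators.
From mathcomp Require Import boolp ring.

Set Implicit Arguments.
Unset Strict Implicit.
Unset Printing Implicit Defensive.

Import GRing.Theory Num.Theory.

(** A cocycle assigns to each edge a value in an abelian group A so that
    reversing an edge negates the value and the total value of a path of length
    two depends only on its endpoints.  Prunes and spider moves preserve the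
    total value of a walk, so a cocycle gives a homomorphism from the fundamental
    group to A ([group_iso_weight]); it is an isomorphism as soon as closed walks
    of equal weight are homotopic and every weight occurs.

    Each edge of H(d,q) changes a single coordinate, so a walk in H(d,q) records
    one walk in the complete graph K_q for each coordinate.  Two consecutive
    steps in different coordinates can be exchanged by a spider move.  Hence a
    walk may be sorted by coordinate: it is homotopic to the concatenation of its
    d coordinate walks, each run along its own line ([homotopic_split]).
    Running a K_q-cocycle in every coordinate gives an A^d-valued cocycle on
    H(d,q) ([hamming_cocycle]), and if the weight and the endpoint classify the
    walks of K_q up to homotopy, the same holds in H(d,q).  So the group is A^d
    ([group_iso_hamming]), and only K_q is left to study.

    In K_3 a spider move changes a walk only at a backtrack, because two
    distinct vertices have a single common neighbour.  The group is then that of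
    a circle: the signed number of passages through the edge from 2 to 0 is an
    integer cocycle, and a walk lifts to the integers, where it reduces to the
    monotone walk with the same endpoint ([homotopic_coil]).

    In K_q with q > 3 the parity of the length is a cocycle.  All triangles
    through a vertex are homotopic, because a fourth vertex provides room to
    change their middle vertices one at a time ([homotopic_triangles]), and a
    path of length three with distinct ends shortens to an edge
    ([homotopic_bypass]).  Thus endpoint and parity determine the class of a
    walk ([homotopic_normal_form]). *)

(** * Homotopies of walks *)

Section Walks.
Variable G : graph.
Implicit Types (x y a b c : G) (s t w : seq G).

Lemma homotopic_refl w : homotopic w w.
Proof. exact: rt_refl. Qed.

Lemma homotopic_trans w2 w1 w3 :
  homotopic w1 w2 -> homotopic w2 w3 -> homotopic w1 w3.
Proof. exact: rt_trans. Qed.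

Lemma homotopic_catr x s s' t :
  path (@adj G) x (s ++ t) -> homotopic (x :: s) (x :: s') ->
  homotopic (x :: s ++ t) (x :: s' ++ t).
Proof. by move=> xst; apply: (@homotopic_cat G _ _ [::] t). Qed.

Lemma homotopic_catl x t s s' :
  path (@adj G) x (t ++ s) ->
  homotopic (last x t :: s) (last x t :: s') ->
  homotopic (x :: t ++ s) (x :: t ++ s').
Proof.
move=> xts ss'.
have catE u : x :: t ++ u = belast x t ++ (last x t :: u) ++ [::].
  by rewrite cats0 -cat_cons lastI cat_rcons.
rewrite !catE; apply: homotopic_cat => //.
by rewrite -catE.
Qed.

Lemma homotopic_spider a b b' c :
  adj a b -> adj b c -> adj a b' -> adj b' c ->
  homotopic [:: a; b; c] [:: a; b'; c].
Proof.
move=> ab bc ab' b'c; apply/rt_step/(@Spider G [::] a b b' c [::]).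
  by rewrite /is_walk /= ab bc.
by rewrite /is_walk /= ab' b'c.
Qed.

Lemma homotopic_prune a b : adj a b -> homotopic [:: a; b; a] [:: a].
Proof.
move=> ab; apply/rt_step/(@Prune G [::] a b [::]).
by rewrite /is_walk /= ab adj_sym ab.
Qed.

End Walks.

Lemma homotopic_map (G H : graph) (f : G -> H) (w w' : seq G) :
  {homo f : x y / adj x y} ->
  homotopic w w' -> homotopic (map f w) (map f w').
Proof.
move=> fP; have walk_map u : is_walk u -> is_walk (map f u).
  by case: u => //= x u; rewrite /is_walk /=; apply: homo_path.
elim=> [{}w {}w' mv|{}w|w1 w2 w3 _ h12 _ h23].
- apply: rt_step; case: mv => [s a b b' c t|s a b t|s a b t].
  + by move=> /walk_map + /walk_map; rewrite !map_cat /=; apply: Spider.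
  + by move=> /walk_map; rewrite !map_cat /=; apply: Prune.
  + by move=> /walk_map; rewrite !map_cat /=; apply: AntiPrune.
- exact: homotopic_refl.
- exact: homotopic_trans h12 h23.
Qed.

(** * Cocycles and the homomorphisms they define *)

Section Weights.
Local Open Scope ring_scope.
Variables (G : graph) (A : zmodType) (e : G -> G -> A).

Fixpoint weight (x : G) (s : seq G) : A :=
  if s is y :: s' then e x y + weight y s' else 0.

(** The first clause makes prunes neutral, and the second one spider moves. *)
Definition cocycle : Prop :=
  (forall x y, adj x y -> e y x = - e x y) /\
  (forall a b b' c, adj a b -> adj b c -> adj a b' -> adj b' c ->
     e a b + e b c = e a b' + e b' c).

Lemma weight_cat x s t : weight x (s ++ t) = weight x s + weight (last x s) t.
Proof. by elim: s x => [|y s IHs] x /=; rewrite ?add0r // IHs addrA. Qed.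

Lemma weight_rcons x s y : weight x (rcons s y) = weight x s + e (last x s) y.
Proof. by rewrite -cats1 weight_cat /= addr0. Qed.

Hypothesis eP : cocycle.

(** Both kinds of moves change a walk inside a window of two edges and leave
    the ends of the window in place, so only that window has to be compared. *)
Lemma weight_homotopic x s x' s' :
  homotopic (x :: s) (x' :: s') -> weight x s = weight x' s'.
Proof.
case: eP => eN eS.
pose W w := if w is y :: t then weight y t else 0.
suff: forall w w', homotopic w w' -> W w = W w' by move=> H /H.
have Wcat w t : w != [::] -> W (w ++ t) = W w + weight (last x w) t.
  by case: w => //= y w _; apply: weight_cat.
have Wpre s1 a t t' : weight a t = weight a t' ->
    W (s1 ++ a :: t) = W (s1 ++ a :: t').
  move=> tt'; rewrite -!cat_rcons !Wcat ?last_rcons ?tt' //;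
    by rewrite -size_eq0 size_rcons.
have prune a b t : adj a b -> weight a [:: b, a & t] = weight a t.
  by move=> ab /=; rewrite addrA (eN _ _ ab) addrN add0r.
move=> w w'; elim=> [{}w {}w' mv|//|w1 w2 w3 _ -> //].
case: mv => [s1 a b b' c t|s1 a b t|s1 a b t].
- rewrite !is_walk_cat_cons /= => /and4P[_ ab bc _] /and4P[_ ab' b'c _].
  by apply: Wpre => /=; rewrite !addrA (eS a b b' c).
- by rewrite is_walk_cat_cons /= => /and3P[_ ab _]; apply/Wpre/prune.
- by rewrite is_walk_cat_cons /= => /and3P[_ ab _]; apply/esym/Wpre/prune.
Qed.

(** The quotient by homotopy embeds in A because the weight is a complete
    invariant, and concatenation adds weights. *)
Lemma group_iso_weight (v : G) :
  (forall p q : closed_walk v, weight v (steps p) = weight v (steps q) ->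
     homotopic (v :: steps p) (v :: steps q)) ->
  (forall m, exists p : closed_walk v, weight v (steps p) = m) ->
  group_iso (fundamental_group v) A.
Proof.
move=> Winj Wsurj.
pose f (g : fundamental_group v) := weight v (steps (repr g)).
have fE p : f (\pi_(fundamental_group v) p)%qT = weight v (steps p).
  by apply: weight_homotopic; apply/cw_equivP/eqmodP; rewrite reprK.
exists f; split.
  have [p pP] := choice Wsurj.
  exists (fun m => \pi_(fundamental_group v) (p m))%qT => [g|m]; last first.
    by rewrite fE.
  rewrite -[RHS]reprK; apply/eqmodP/cw_equivP/Winj; exact: pP.
move=> g h; rewrite [LHS]fE /= weight_cat.
by have /andP[_ /eqP ->] := stepsP (repr g).
Qed.

End Weights.

(** * Walks in Hamming graphs, sorted by coordinate *)

Lemma complete_sym (T : choiceType) : symmetric (fun x y : T => x != y).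
Proof. by move=> x y; rewrite eq_sym. Qed.

Lemma complete_irr (T : choiceType) : irreflexive (fun x y : T => x != y).
Proof. by move=> x; rewrite eqxx. Qed.

Definition complete (T : choiceType) : graph :=
  Graph (@complete_sym T) (@complete_irr T).

Arguments adj : simpl never.

Section HammingWalks.
Variables d q : nat.
Notation H := (hamming d q).
Notation K := (complete 'I_q).
Implicit Types (i j : 'I_d) (a b c : 'I_q) (x y z : H) (r : seq 'I_d).
Implicit Types (s t : seq H) (u : 'I_d -> seq K).

Definition upd x i a : H := [ffun j => if j == i then a else x j].

Lemma updE x i a j : upd x i a j = if j == i then a else x j.
Proof. exact: ffunE. Qed.

Lemma upd_id x i : upd x i (x i) = x.
Proof. by apply/ffunP => j; rewrite updE; case: (eqVneq j i) => // ->. Qed.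

Lemma updK x i a b : upd (upd x i a) i b = upd x i b.
Proof. by apply/ffunP => j; rewrite !updE; case: eqP. Qed.

Lemma updC x i j a b : i != j -> upd (upd x i a) j b = upd (upd x j b) i a.
Proof.
move=> ij; apply/ffunP => k; rewrite !updE.
by case: (eqVneq k j) => // ->; rewrite eq_sym (negPf ij).
Qed.

Lemma adj_upd x i a : adj x (upd x i a) = (x i != a).
Proof.
rewrite /adj /hamming /hamming_adj; case: (eqVneq (x i) a) => [<-|xa] /=.
  by rewrite upd_id; under eq_finset do rewrite eqxx; rewrite cards0.
apply/cards1P; exists i; apply/setP => j; rewrite !inE updE.
by case: (eqVneq j i) => [->|_]; rewrite ?xa ?eqxx.
Qed.

Lemma adj_coord x y i j : adj x y -> x i != y i -> j != i -> x j = y j.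
Proof.
case/cards1P=> k /setP xy xi ji.
have := xy i; rewrite !inE xi => /esym/eqP ik.
by have := xy j; rewrite !inE -ik (negPf ji) => /negbFE/eqP.
Qed.

Lemma adj_updP x y :
  reflect (exists2 i, x i != y i & y = upd x i (y i)) (adj x y).
Proof.
apply: (iffP idP) => [xy|[i xi ->]]; last by rewrite adj_upd.
have [i /setP/(_ i)] := cards1P xy; rewrite !inE eqxx => xi; exists i => //.
apply/ffunP => j; rewrite updE; case: eqP => [->//|/eqP ji].
by rewrite (adj_coord xy xi ji).
Qed.

Lemma upd_homo x i : {homo (upd x i : K -> H) : a b / adj a b}.
Proof. by move=> a b ab; rewrite -(updK x i a b) adj_upd updE eqxx. Qed.

Lemma adj_upd2 x y i a : x i = y i -> adj x y -> adj (upd x i a) (upd y i a).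
Proof.
move=> xyi /adj_updP[j xyj ->].
have ji : j != i by apply: contraNneq xyj => ->; rewrite xyi.
by rewrite updC // adj_upd updE (negPf ji).
Qed.

Definition line i z (s : seq K) : seq H := map (upd z i) s.

Lemma path_line i z (s : seq K) :
  path (@adj K) (z i) s -> path (@adj H) z (line i z s).
Proof.
by move=> zs; rewrite -{1}(upd_id z i); apply: homo_path zs; exact: upd_homo.
Qed.

Lemma last_line i z (s : seq K) : last z (line i z s) = upd z i (last (z i) s).
Proof. by rewrite -{1}(upd_id z i) last_map. Qed.

Lemma homotopic_line i z (s s' : seq K) :
  @homotopic K (z i :: s) (z i :: s') ->
  homotopic (z :: line i z s) (z :: line i z s').
Proof. by move/(homotopic_map (@upd_homo z i)); rewrite /= !upd_id. Qed.

(** A last step in direction [i] moves to the front of a walk that never uses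
    direction [i]: each exchange with the preceding step is a spider move across
    a square of the grid. *)
Lemma homotopic_slide i b z s :
  path (@adj H) z s -> {in s, forall y, y i = z i} -> z i != b ->
  homotopic (z :: rcons s (upd (last z s) i b))
            (z :: upd z i b :: map (fun y => upd y i b) s).
Proof.
elim: s z => [|y s IHs] z /=; first by move=> *; exact: homotopic_refl.
case/andP=> zy ys si zb.
have yz : y i = z i by apply: si; rewrite mem_head.
have si' : {in s, forall x, x i = y i}.
  by move=> x xs; rewrite yz; apply: si; rewrite inE xs orbT.
have yb : y i != b by rewrite yz.
have path_upd : path (@adj H) (upd y i b) (map (fun y => upd y i b) s).
  elim: s y ys si' {yz yb zy IHs si} => //= x s IHs y /andP[yx xs] si.
  have xi : x i = y i by apply: si; rewrite mem_head.
  rewrite adj_upd2 //=; apply: IHs => // x' x's.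
  by rewrite xi; apply: si; rewrite inE x's orbT.
apply: (homotopic_trans
  (w2 := z :: y :: upd y i b :: map (fun y => upd y i b) s)).
  apply: (@homotopic_catl H z [:: y]); last exact: IHs.
  rewrite /= zy rcons_path ys adj_upd.
  suff -> : last y s i = y i by [].
  case/lastP: s {IHs ys si path_upd} si' => // s x -> //.
  by rewrite last_rcons mem_rcons mem_head.
apply: (@homotopic_catr H z [:: y; upd y i b] [:: upd z i b; upd y i b]).
  by rewrite /= zy adj_upd yb.
by apply: homotopic_spider; rewrite ?adj_upd ?adj_upd2.
Qed.

(** The sorted walk with coordinate walks [u i].  The list [r] of directions is a
    parameter so that an induction can drop the first block. *)
Fixpoint blocks u r z : seq H :=
  if r is i :: r' then
    line i z (u i) ++ blocks u r' (upd z i (last (z i) (u i)))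
  else [::].

Definition walks_from z u := forall i, path (@adj K) (z i) (u i).

Lemma eq_blocks u u' r z : {in r, u =1 u'} -> blocks u r z = blocks u' r z.
Proof.
elim: r z => //= i r IHr z uu'; rewrite uu' ?mem_head // IHr // => j jr.
by apply: uu'; rewrite inE jr orbT.
Qed.

Lemma blocks_upd u r z i b : i \notin r ->
  map (fun y => upd y i b) (blocks u r z) = blocks u r (upd z i b).
Proof.
elim: r z => //= j r IHr z; rewrite inE negb_or => /andP[ij ir].
rewrite map_cat -map_comp IHr // updE eq_sym (negPf ij) -(updC _ _ _ ij).
congr (_ ++ _); apply: eq_map => a /=.
by rewrite updC // eq_sym.
Qed.

Lemma blocks_fix u r z i : i \notin r -> {in blocks u r z, forall y, y i = z i}.
Proof.
elim: r z => //= j r IHr z; rewrite inE negb_or => /andP[ij ir] y.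
rewrite mem_cat => /orP[/mapP[a _ ->]|/(IHr _ ir) ->];
  by rewrite updE (negPf ij).
Qed.

Lemma last_blocks u r z : uniq r -> forall i,
  last z (blocks u r z) i = if i \in r then last (z i) (u i) else z i.
Proof.
elim: r z => //= j r IHr z /andP[jr ur] i.
rewrite last_cat last_line IHr // inE updE.
by case: (eqVneq i j) => [->|]; rewrite ?(negPf jr).
Qed.

Lemma path_blocks u r z : uniq r ->
  {in r, forall i, path (@adj K) (z i) (u i)} -> path (@adj H) z (blocks u r z).
Proof.
elim: r z => //= i r IHr z /andP[ir ur] zu.
rewrite cat_path path_line ?zu ?mem_head // last_line IHr // => j jr.
rewrite updE; case: eqP jr => [->|_ jr]; first by rewrite (negPf ir).
by apply: zu; rewrite inE jr orbT.
Qed.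

(** Homotopies in K_q apply to each coordinate walk in turn. *)
Lemma homotopic_blocks u u' r z : uniq r ->
  {in r, forall i, path (@adj K) (z i) (u i)} ->
  {in r, forall i, path (@adj K) (z i) (u' i)} ->
  {in r, forall i, last (z i) (u i) = last (z i) (u' i)} ->
  {in r, forall i, @homotopic K (z i :: u i) (z i :: u' i)} ->
  homotopic (z :: blocks u r z) (z :: blocks u' r z).
Proof.
elim: r z => [|i r IHr] z; first by move=> *; exact: homotopic_refl.
case/andP=> ir ur zu zu' lu hu.
have ir0 := mem_head i r.
set z' := upd z i (last (z i) (u i)).
have tl j : j \in r -> j \in i :: r /\ z' j = z j.
  by move=> jr; rewrite inE jr orbT updE; case: eqP jr ir => // -> ->.
have zur : {in r, forall j, path (@adj K) (z' j) (u j)}.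
  by move=> j /tl[? ->]; apply: zu.
have zur' : {in r, forall j, path (@adj K) (z' j) (u' j)}.
  by move=> j /tl[? ->]; apply: zu'.
apply: (homotopic_trans (w2 := z :: line i z (u' i) ++ blocks u r z')).
  apply: homotopic_catr; last by apply: homotopic_line; apply: hu.
  by apply: (@path_blocks u (i :: r) z); rewrite //= ir.
rewrite /= -lu // -/z'; apply: homotopic_catl.
  by rewrite cat_path path_line ?zu' //= last_line -lu // path_blocks.
rewrite last_line -lu //; apply: IHr => // j /tl[? ->]; first exact: lu.
exact: hu.
Qed.

Definition extend u i b : 'I_d -> seq K :=
  fun j => if j == i then rcons (u i) b else u j.

(** A step added at the end of a sorted walk slides back over the blocks of the
    later coordinates and is absorbed by the block of its own coordinate. *)
Lemma homotopic_blocks_rcons u r z i b : uniq r -> i \in r ->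
  {in r, forall j, path (@adj K) (z j) (u j)} -> last (z i) (u i) != b ->
  homotopic (z :: rcons (blocks u r z) (upd (last z (blocks u r z)) i b))
            (z :: blocks (extend u i b) r z).
Proof.
elim: r z => //= k r IHr z /andP[kr ur] ir zu lb.
set z' := upd z k (last (z k) (u k)).
have lz : last z (line k z (u k)) = z' by rewrite last_line.
have pl : path (@adj H) z (line k z (u k)) by rewrite path_line ?zu ?mem_head.
have tl j : j \in r -> z' j = z j.
  by move=> jr; rewrite updE; case: eqP jr kr => // -> ->.
have zur : {in r, forall j, path (@adj K) (z' j) (u j)}.
  by move=> j jr; rewrite tl // zu // inE jr orbT.
have pr := path_blocks ur zur.
have lbr : last z (blocks u (k :: r) z) i != b.
  by rewrite last_blocks /= ?kr // ir.
have pb :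
    path (@adj H) z' (rcons (blocks u r z') (upd (last z' (blocks u r z')) i b)).
  by rewrite rcons_path pr adj_upd; move: lbr; rewrite /= last_cat lz.
rewrite last_cat lz rcons_cat.
case: (eqVneq i k) ir lb => [ik _ lb|ik]; last first.
  rewrite inE (negPf ik) /= => ir lb.
  rewrite /extend eq_sym (negPf ik).
  apply: homotopic_catl; rewrite ?cat_path ?pl lz //.
  by apply: IHr => //; rewrite tl.
have ir : i \notin r by rewrite ik.
have z'i : z' i = last (z i) (u i) by rewrite updE ik eqxx.
have -> : blocks (extend u i b) r (upd z k (last (z k) (extend u i b k))) =
    map (fun y => upd y i b) (blocks u r z').
  rewrite blocks_upd // /z' -ik updK /extend eqxx last_rcons.
  by apply: eq_blocks => j jr; case: eqP jr ir => // -> ->.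
have -> : line k z (extend u i b k) = line k z (u k) ++ [:: upd z' i b].
  by rewrite -ik /extend eqxx /line map_rcons cats1 /z' -ik updK.
rewrite -catA /=; apply: homotopic_catl; first by rewrite cat_path pl lz.
rewrite lz; apply: homotopic_slide => //; last by rewrite z'i.
exact: blocks_fix.
Qed.

(** Sorting by insertion: the steps of the walk are absorbed one at a time. *)
Lemma homotopic_split z s : path (@adj H) z s ->
  exists u, [/\ walks_from z u, last z s = last z (blocks u (enum 'I_d) z) &
    homotopic (z :: s) (z :: blocks u (enum 'I_d) z)].
Proof.
elim/last_ind: s => [_|s y IHs].
  exists (fun=> [::]); suff -> : blocks (fun=> [::]) (enum 'I_d) z = [::].
    by split=> //; exact: homotopic_refl.
  by elim: (enum _) => //= i r; rewrite upd_id.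
rewrite rcons_path => /andP[zs sy]; have [u [zu su hu]] := IHs zs.
have ud := enum_uniq 'I_d; have id i : i \in enum 'I_d by rewrite mem_enum.
have lE u' j : last z (blocks u' (enum 'I_d) z) j = last (z j) (u' j).
  by rewrite last_blocks // id.
have [i syi yE] := adj_updP _ _ sy; exists (extend u i (y i)).
have lb : last (z i) (u i) != y i by rewrite -lE -su.
split.
- move=> j; rewrite /extend; case: eqP => [->|_]; last exact: zu.
  by rewrite rcons_path zu.
- rewrite last_rcons; apply/ffunP => j; rewrite lE /extend yE !updE.
  by case: eqP => [->|_]; rewrite ?eqxx ?last_rcons // su lE.
- apply: (homotopic_trans _ (homotopic_blocks_rcons ud (id i) _ lb)) => //.
  rewrite -su -yE -!cats1; apply: homotopic_catr => //.
  by rewrite cat_path zs /= sy.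
Qed.

Section HammingWeight.
Local Open Scope ring_scope.
Variables (A : zmodType) (e : K -> K -> A).
Hypotheses (eP : cocycle e) (e0 : forall a, e a a = 0).

Definition hamming_weight x y : 'rV[A]_d := \row_i e (x i) (y i).

(** Fix a coordinate [i] and a path x, y, z with x and z distinct at [i].  If x
    and z agree elsewhere, every common neighbour of them lies on their line and
    the K_q-cocycle property applies.  Otherwise no common neighbour leaves the
    two values at [i], so exactly one of the two steps changes [i], and it
    contributes e (x i) (z i). *)
Lemma hamming_cocycle : cocycle hamming_weight.
Proof.
case: eP => eN eS.
have eN' a b : e b a = - e a b.
  by case: (eqVneq a b) => [->|/eN //]; rewrite e0 oppr0.
split=> [x y _|x y y' z]; first by apply/rowP => i; rewrite !mxE.
move=> xy yz xy' y'z; apply/rowP => i; rewrite !mxE.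
have [<-|xz] := eqVneq (x i) (z i).
  by rewrite [e (y i) _]eN' [e (y' i) _]eN' !addrN.
have [/forall_inP xzE|/forall_inPn[j ji xzj]] :=
  boolP [forall (j | j != i), x j == z j].
  have off w : adj x w -> adj w z -> (x i != w i) && (w i != z i).
    move=> xw wz; apply/andP; split; apply/eqP => wi.
      suff xwE : x = w by rewrite xwE adj_irr in xw.
      apply/ffunP => j; have [-> //|ji] := eqVneq j i.
      by rewrite (eqP (xzE j ji)) (adj_coord wz _ ji) // -wi.
    suff wzE : w = z by rewrite wzE adj_irr in wz.
    apply/ffunP => j; have [-> //|ji] := eqVneq j i.
    by rewrite -(eqP (xzE j ji)) (adj_coord xw _ ji) // wi.
  have /andP[xyi yzi] := off _ xy yz; have /andP[xyi' yzi'] := off _ xy' y'z.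
  exact: eS.
have on w : adj x w -> adj w z -> e (x i) (w i) + e (w i) (z i) = e (x i) (z i).
  move=> xw wz; have [<-|xwi] := eqVneq (x i) (w i); first by rewrite e0 add0r.
  have [->|wzi] := eqVneq (w i) (z i); first by rewrite e0 addr0.
  by rewrite (adj_coord xw xwi ji) (adj_coord wz wzi ji) eqxx in xzj.
by rewrite !on.
Qed.

Lemma weight_line i z (s : seq K) j :
  weight hamming_weight z (line i z s) 0 j =
    if j == i then weight e (z i) s else 0.
Proof.
elim: s z => [|a s IHs] z /=; first by rewrite mxE if_same.
have -> : line i z s = line i (upd z i a) s.
  by apply: eq_map => b; rewrite /= updK.
rewrite !mxE IHs !updE eqxx; case: eqP => [->//|_].
by rewrite e0 addr0.
Qed.

Lemma weight_blocks u r z j : uniq r ->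
  weight hamming_weight z (blocks u r z) 0 j =
    if j \in r then weight e (z j) (u j) else 0.
Proof.
elim: r z => [|i r IHr] z /=; first by rewrite mxE.
case/andP=> ir ur; rewrite weight_cat mxE weight_line last_line IHr // inE updE.
by case: (eqVneq j i) => [->|_]; rewrite ?(negPf ir) ?addr0 ?add0r.
Qed.

(** Sorted walks with equal ends and equal weights have coordinate walks with
    equal ends and equal weights, so the classification in K_q finishes. *)
Lemma homotopic_hamming z :
  (forall i (s t : seq K), path (@adj K) (z i) s -> path (@adj K) (z i) t ->
     last (z i) s = last (z i) t -> weight e (z i) s = weight e (z i) t ->
     @homotopic K (z i :: s) (z i :: t)) ->
  forall s t, path (@adj H) z s -> path (@adj H) z t -> last z s = last z t ->
    weight hamming_weight z s = weight hamming_weight z t ->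
    homotopic (z :: s) (z :: t).
Proof.
move=> Kz s t zs zt st wst; have eHP := hamming_cocycle.
have [u [zu su hu]] := homotopic_split zs.
have [u' [zu' tu' hu']] := homotopic_split zt.
have ud := enum_uniq 'I_d.
apply: (homotopic_trans hu (homotopic_trans _ (homotopic_sym hu'))).
have lu i : last (z i) (u i) = last (z i) (u' i).
  have : last z (blocks u (enum 'I_d) z) i = last z (blocks u' (enum 'I_d) z) i.
    by rewrite -su -tu' st.
  by rewrite !last_blocks // mem_enum.
have wu i : weight e (z i) (u i) = weight e (z i) (u' i).
  have := wst; rewrite (weight_homotopic eHP hu) (weight_homotopic eHP hu').
  by move/rowP/(_ i); rewrite !weight_blocks // mem_enum.
by apply: homotopic_blocks => // i _; apply: Kz.
Qed.

Lemma group_iso_hamming z :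
  (forall i (s t : seq K), path (@adj K) (z i) s -> path (@adj K) (z i) t ->
     last (z i) s = last (z i) t -> weight e (z i) s = weight e (z i) t ->
     @homotopic K (z i :: s) (z i :: t)) ->
  (forall i m, exists s : seq K, [/\ path (@adj K) (z i) s,
     last (z i) s = z i & weight e (z i) s = m]) ->
  group_iso (fundamental_group z) 'rV[A]_d.
Proof.
move=> Kinj Ksurj; apply: (group_iso_weight hamming_cocycle) => [p p'|m].
  have /andP[pp /eqP lp] := stepsP p; have /andP[pp' /eqP lp'] := stepsP p'.
  by apply: homotopic_hamming => //; rewrite lp lp'.
have [u uP] := choice (fun i => Ksurj i (m 0 i)); have ud := enum_uniq 'I_d.
have uC : path (@adj H) z (blocks u (enum 'I_d) z) &&
          (last z (blocks u (enum 'I_d) z) == z).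
  rewrite path_blocks //=; last by move=> i _; have [] := uP i.
  apply/eqP/ffunP => i; rewrite last_blocks // mem_enum.
  by have [] := uP i.
exists (ClosedWalk uC); apply/rowP => i.
by rewrite /= weight_blocks // mem_enum; have [] := uP i.
Qed.

End HammingWeight.
End HammingWalks.

(** * Complete graphs: classification by normal forms *)

Lemma homotopic_of_normal_form (G : graph) (A : zmodType) (e : G -> G -> A)
    (v : G) (nf : G -> A -> seq G) :
  (forall s, path (@adj G) v s ->
     homotopic (v :: s) (v :: nf (last v s) (weight e v s))) ->
  forall s t, path (@adj G) v s -> path (@adj G) v t ->
    last v s = last v t -> weight e v s = weight e v t ->
    homotopic (v :: s) (v :: t).
Proof.
move=> nfP s t vs vt lst wst; apply: homotopic_trans (nfP s vs) _.
by rewrite lst wst; apply/homotopic_sym/nfP.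
Qed.

(** * The triangle K_3 *)

Section Triangle.
Local Open Scope ring_scope.
Notation K := (complete 'I_3).
Implicit Types (a b c : K) (s t : seq K).

(** The circle cut at the edge between 2 and 0: only that edge carries weight, so
    the weight of a closed walk is its winding number. *)
Definition crossing (a b : K) : int :=
  ((a == 2 :> nat) && (b == 0 :> nat))%:R
  - ((a == 0 :> nat) && (b == 2 :> nat))%:R.

Lemma crossing0 a : crossing a a = 0.
Proof. by rewrite /crossing andbC subrr. Qed.

Lemma crossing_cocycle : cocycle crossing.
Proof.
split=> [a b _|a b b' c ab bc ab' b'c].
  by rewrite /crossing opprB (andbC (b == 2 :> nat)) (andbC (b == 0 :> nat)).
have [<-|ac] := eqVneq a c.
  by rewrite /crossing; case: a b b' {ab bc ab' b'c} =>
    [[|[|[|a]]] ha] [[|[|[|b]]] hb] [[|[|[|b']]] hb'].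
(* Two distinct vertices of K_3 have only one common neighbour. *)
suff -> : b = b' by [].
move: ab bc ab' b'c ac; rewrite /adj /= => ab bc ab' b'c ac.
apply: contraTeq isT => bb'.
have := max_card (mem [:: a; b; b'; c : 'I_3]).
rewrite (card_uniqP _) ?card_ord //= !inE !negb_or.
by rewrite ab ab' ac bb' bc b'c.
Qed.

Definition base3 : K := ord0.

(** The endpoint of the lift of [s] to the integers, the universal cover of the
    triangle: one crossing of the cut edge starts a new period of length 3. *)
Definition lift s : int :=
  weight crossing base3 s *+ 3 + (last base3 s : nat)%:Z.

Definition residue (m : int) : K := (m%:~R : 'Z_3).

Lemma crossing_step a b : adj a b ->
  exists2 k : int, k = 1 \/ k = - 1 &
    (b : nat)%:Z = (a : nat)%:Z - crossing a b *+ 3 + k.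
Proof.
case: a b => [[|[|[|a]]] ha] [[|[|[|b]]] hb] // _;
  rewrite /crossing /=;
  (exists 1; [by left | done]) || (exists (- 1); [by right | done]).
Qed.

(** The covering map sends the end of the lift to the end of the walk. *)
Lemma residue_lift s : residue (lift s) = last base3 s.
Proof.
rewrite /residue /lift rmorphD rmorphMn /= -mulr_natr.
have -> : 3%:R = 0 :> 'Z_3 by apply: val_inj.
by rewrite mulr0 add0r -pmulrn; exact: (natr_Zp (last base3 s : 'Z_3)).
Qed.

Lemma lift_rcons s b : adj (last base3 s) b ->
  exists2 k : int, k = 1 \/ k = - 1 & lift (rcons s b) = lift s + k.
Proof.
move=> /crossing_step[k k1 bE]; exists k => //.
rewrite /lift weight_rcons last_rcons bE mulrnDl; ring.
Qed.

(** The image in the triangle of the integer walk k, 2k, ..., nk; it is used for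
    k = 1 and k = -1. *)
Definition spiral (k : int) n : seq K := mkseq (fun l => residue (k *+ l.+1)) n.

Lemma spiralS k n : spiral k n.+1 = rcons (spiral k n) (residue (k *+ n.+1)).
Proof. exact: mkseqS. Qed.

Lemma last_spiral k n : last base3 (spiral k n) = residue (k *+ n).
Proof.
case: n => [|n]; last by rewrite spiralS last_rcons.
by rewrite mulr0n; apply: val_inj.
Qed.

Lemma adj_residue m k : k = 1 \/ k = - 1 -> adj (residue m) (residue (m + k)).
Proof.
rewrite /adj /= /residue rmorphD /= -subr_eq0 opprD addNKr.
by case=> ->.
Qed.

Lemma path_spiral k n : k = 1 \/ k = - 1 -> path (@adj K) base3 (spiral k n).
Proof.
move=> k1; elim: n => // n IHn.
by rewrite spiralS rcons_path IHn last_spiral mulrSr adj_residue.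
Qed.

(** Since 1 and -1 differ modulo 3, the residues determine the direction of
    each lifted step. *)
Lemma lift_spiral n k : k = 1 \/ k = - 1 -> lift (spiral k n) = k *+ n.
Proof.
move=> k1; elim: n => [|n IHn]; first by rewrite mulr0n /lift /= add0r.
have := path_spiral n.+1 k1; rewrite spiralS rcons_path => /andP[_ /lift_rcons].
case=> k' k'1 liftE; rewrite liftE IHn mulrSr; congr (_ + _).
have := residue_lift (rcons (spiral k n) (residue (k *+ n.+1))).
rewrite liftE last_rcons IHn mulrSr /residue !rmorphD /= => /addrI.
by case: k1 k'1 => -> [] ->.
Qed.

(** The image of the monotone integer walk from 0 to [m]. *)
Definition coil (m : int) : seq K := spiral (Num.sg m) `|m|%N.

Lemma coilE (k : int) n : k = 1 \/ k = - 1 ->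
  coil (k *+ n) = spiral k n.
Proof.
move=> k1; rewrite /coil; case: n => [//|n].
rewrite -mulr_natr natz abszM absz_nat sgrM.
rewrite (gtr0_sg (_ : 0 < n.+1%:Z)) // mulr1.
by case: k1 => ->; rewrite ?sgrN sgr1 ?abszN absz1 mul1n.
Qed.

(** Decides whether a step by [k] lengthens or shortens the monotone walk from 0
    to [m]. *)
Lemma signed_nat (m : int) k : k = 1 \/ k = - 1 ->
  (exists n, m = k *+ n) \/ (exists n, m = - k *+ n.+1).
Proof.
case=> ->; case: m => n.
- by left; exists n; rewrite natz.
- by right; exists n; rewrite NegzE mulNrn natz.
- case: n => [|n]; first by left; exists 0.
  by right; exists n; rewrite opprK natz.
- by left; exists n.+1; rewrite NegzE mulNrn natz.
Qed.

(** A further step of the lift either continues the monotone walk, or undoes its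
    last step and is pruned. *)
Lemma homotopic_coil s : path (@adj K) base3 s ->
  homotopic (base3 :: s) (base3 :: coil (lift s)).
Proof.
elim/last_ind: s => [_|s b IHs]; first exact: homotopic_refl.
rewrite rcons_path => /andP[os sb]; have [k k1 liftE] := lift_rcons sb.
apply: (homotopic_trans (w2 := base3 :: rcons (coil (lift s)) b)).
  by rewrite -!cats1; apply: homotopic_catr (IHs os); rewrite cat_path os /= sb.
have bE : b = residue (lift s + k) by rewrite -liftE residue_lift last_rcons.
rewrite liftE bE; have [[n ->]|[n ->]] := signed_nat (lift s) k1.
  rewrite -mulrSr !coilE // spiralS; exact: homotopic_refl.
have k1' : - k = 1 \/ - k = - 1 by case: k1 => ->; [right|left; rewrite opprK].
rewrite mulrSr subrK -mulrSr !coilE // spiralS -cats1.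
rewrite -{2}[spiral (- k) n]cats0 cat_rcons.
have := path_spiral n.+1 k1'; rewrite spiralS rcons_path => /andP[pn ln].
apply: homotopic_catl.
  by rewrite cat_path pn /= ln -(last_spiral (- k) n) adj_sym ln.
by rewrite /= -(last_spiral (- k) n); apply: homotopic_prune.
Qed.

(** Three n steps in one direction wind n times around the triangle. *)
Lemma crossing_surj (m : int) : exists s : seq K,
  [/\ path (@adj K) base3 s, last base3 s = base3 &
      weight crossing base3 s = m].
Proof.
have [n [k [k1 mE]]] : exists n k, (k = 1 \/ k = - 1) /\ m = k *+ n.
  have [[n ->]|[n ->]] := signed_nat m (or_introl erefl).
    by exists n, 1; split=> //; left.
  by exists n.+1, (- 1); split=> //; right.
have last0 : last base3 (spiral k (n * 3)) = base3.
  rewrite last_spiral mulrnA /residue -mulr_natr intrM.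
  have -> : 3%:~R = 0 :> 'Z_3 by apply: val_inj.
  by rewrite mulr0.
exists (spiral k (n * 3)); split=> //; first exact: path_spiral.
have := lift_spiral (n * 3) k1; rewrite /lift last0 mE /= addr0 mulrnA.
exact: pmulrnI.
Qed.

Lemma homotopic_crossing s t :
  path (@adj K) base3 s -> path (@adj K) base3 t ->
  last base3 s = last base3 t ->
  weight crossing base3 s = weight crossing base3 t ->
  homotopic (base3 :: s) (base3 :: t).
Proof.
apply: (@homotopic_of_normal_form _ _ crossing base3
  (fun a m => coil (m *+ 3 + (a : nat)%:Z))).
exact: homotopic_coil.
Qed.

End Triangle.

(** * Complete graphs on at least four vertices *)

Section Parity.
Local Open Scope ring_scope.
Variables (q : nat) (hq : (3 < q)%N) (o : complete 'I_q).
Notation K := (complete 'I_q).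
Implicit Types (a b c : K) (s t : seq K).

(** Every step weighs 1, so the weight of a walk is its length modulo 2. *)
Definition parity (a b : K) : 'Z_2 := (a != b)%:R.

Lemma parity0 a : parity a a = 0.
Proof. by rewrite /parity eqxx. Qed.

Lemma parity_adj a b : adj a b -> parity a b = 1.
Proof. by rewrite /adj /parity /= => ->. Qed.

Lemma parity_cocycle : cocycle parity.
Proof.
split=> [a b ab|a b b' c ab bc ab' b'c]; last by rewrite !parity_adj.
by rewrite (parity_adj ab) parity_adj 1?adj_sym //; apply: val_inj.
Qed.

Definition fresh (s : seq K) : K := odflt o [pick c : 'I_q | c \notin s].

Lemma freshP s : (size s <= 3)%N -> fresh s \notin s.
Proof.
move=> s3; rewrite /fresh; case: pickP => [c //|full].
have : (#|'I_q| <= size s)%N.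
  apply: leq_trans (card_size (s : seq 'I_q)).
  apply/subset_leq_card/subsetP => c _.
  by have := full c; move/negbFE.
by rewrite card_ord leqNgt (leq_ltn_trans s3 hq).
Qed.

(** A spider move turns the second vertex into the last one, which creates a
    backtrack. *)
Lemma homotopic_bypass a b c c' :
  adj a b -> adj b c -> adj c c' -> adj a c' ->
  homotopic [:: a; b; c; c'] [:: a; c'].
Proof.
move=> ab bc cc' ac'.
apply: (homotopic_trans (w2 := [:: a; c'; c; c'])).
  apply: (@homotopic_catr K a [:: b; c] [:: c'; c] [:: c']).
    by rewrite /= ab bc cc'.
  by apply: homotopic_spider; rewrite // adj_sym.
apply: (@homotopic_catl K a [:: c'] [:: c; c'] [::]).
  by rewrite /= ac' cc' adj_sym cc'.
by apply: homotopic_prune; rewrite adj_sym.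
Qed.

(** The chain b c, t c, t c', b' c' passes through a vertex [t] distinct from a,
    c and c'; this is where a fourth vertex is necessary. *)
Lemma homotopic_triangles a b c b' c' :
  adj a b -> adj b c -> adj c a -> adj a b' -> adj b' c' -> adj c' a ->
  homotopic [:: a; b; c; a] [:: a; b'; c'; a].
Proof.
move=> ab bc ca ab' bc' ca'.
have := @freshP [:: a; c; c'] isT; set t := fresh _.
rewrite !inE !negb_or => /and3P[ta tc tc'].
have front x x' y : adj a x -> adj x y -> adj a x' -> adj x' y -> adj y a ->
    homotopic [:: a; x; y; a] [:: a; x'; y; a].
  move=> ax xy ax' x'y ya.
  apply: (@homotopic_catr K a [:: x; y] [:: x'; y] [:: a]).
    by rewrite /= ax xy ya.
  exact: homotopic_spider.
have at_ : adj a t by rewrite adj_sym.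
apply: (homotopic_trans (front b t c ab bc at_ tc ca)).
apply: (homotopic_trans (w2 := [:: a; t; c'; a])); last exact: front.
apply: (@homotopic_catl K a [:: t] [:: c; a] [:: c'; a]).
  by rewrite /= at_ ca !andbT; exact: tc.
exact: (@homotopic_spider K t c c' a).
Qed.

(** A walk of least length from [o] to [a] among those with length of parity
    [m]. *)
Definition normal_form a (m : 'Z_2) : seq K :=
  if m == 0 then if a == o then [::] else [:: fresh [:: o; a]; a]
  else if a == o then [:: fresh [:: o]; fresh [:: o; fresh [:: o]]; o]
  else [:: a].

Lemma fresh2P a b : adj a (fresh [:: a; b]) /\ adj (fresh [:: a; b]) b.
Proof.
have := @freshP [:: a; b] isT; rewrite !inE negb_or => /andP[fa fb].
by rewrite adj_sym.
Qed.

Lemma fresh1P a : adj a (fresh [:: a]).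
Proof. by have := @freshP [:: a] isT; rewrite inE adj_sym. Qed.

(** Adding a step to a normal form of length one or two gives a prune, a spider
    move, a bypass or a triangle.  For a step added to the triangle at [o], the
    triangle is first replaced by one that starts at the middle vertex chosen
    for [b], and the rest is then a bypass. *)
Lemma homotopic_normal_form s : path (@adj K) o s ->
  homotopic (o :: s) (o :: normal_form (last o s) (weight parity o s)).
Proof.
elim/last_ind: s => [_|s b IHs].
  by rewrite /= /normal_form !eqxx; apply: homotopic_refl.
rewrite rcons_path last_rcons weight_rcons => /andP[os sb].
rewrite (parity_adj sb).
move: sb (IHs os); set a := last _ _; set m := weight _ _ _ => ab h.
suff: homotopic (o :: rcons (normal_form a m) b) (o :: normal_form b (m + 1)).
  apply: homotopic_trans; rewrite -!cats1; apply: homotopic_catr h.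
  by rewrite cat_path os /= -/a ab.
have [of_ fa] := fresh2P o a; have [of' fb] := fresh2P o b.
have o1 := fresh1P o; have [o3 o2] := fresh2P o (fresh [:: o]).
rewrite adj_sym in o2; rewrite adj_sym in o3.
have [m0|m1] : m = 0 \/ m = 1.
  by case: m {h} => [[|[|m]] hm]; [left|right|]; try exact: val_inj.
- rewrite m0 /normal_form add0r oner_eq0 eqxx.
  have [ao|ao] := eqVneq a o.
    have [bo|_] := eqVneq b o; first by rewrite ao bo adj_irr in ab.
    exact: homotopic_refl.
  have [bo|bo] := eqVneq b o; last first.
    by apply: homotopic_bypass => //; rewrite /adj /= eq_sym.
  rewrite bo in ab *; apply: homotopic_triangles => //.
rewrite m1 /normal_form oner_eq0 (_ : 1 + 1 = 0) ?eqxx; last exact: val_inj.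
have [ao|ao] := eqVneq a o; last first.
  have [bo|bo] := eqVneq b o.
    by rewrite bo; apply: homotopic_prune; rewrite /adj /= eq_sym.
  apply: homotopic_spider => //.
  by rewrite /adj /= eq_sym.
have [bo|bo] := eqVneq b o; first by rewrite ao bo adj_irr in ab.
have ob : adj o b by rewrite /adj /= eq_sym.
set z := fresh [:: o; b] in of' fb *.
(* The triangle o, z, y replaces the one chosen at [o]: its first vertex is the
   middle of the normal form for [b]. *)
have [oy yz] := fresh2P o z; set y := fresh [:: o; z] in oy yz.
rewrite adj_sym in oy; rewrite adj_sym in yz.
apply: (homotopic_trans (w2 := [:: o; z; y; o; b])).
  apply: (@homotopic_catr K o [:: _; _; o] [:: z; y; o] [:: b]).
    by rewrite /= o1 o2 o3 ob.
  exact: homotopic_triangles.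
apply: (@homotopic_catl K o [:: z] [:: y; o; b] [:: b]).
  by rewrite /= of' yz oy ob.
exact: homotopic_bypass.
Qed.

Lemma parity_surj (m : 'Z_2) : exists s : seq K, [/\ path (@adj K) o s,
     last o s = o & weight parity o s = m].
Proof.
have [m0|m1] : m = 0 \/ m = 1.
  by case: m => [[|[|m]] hm]; [left|right|]; try exact: val_inj.
  by exists [::].
have o1 := fresh1P o; have [o3 o2] := fresh2P o (fresh [:: o]).
exists [:: fresh [:: o]; fresh [:: o; fresh [:: o]]; o].
rewrite adj_sym in o2; rewrite adj_sym in o3.
rewrite /= o1 o2 o3 !parity_adj // m1.
by split=> //; apply: val_inj.
Qed.

Lemma homotopic_parity s t :
  path (@adj K) o s -> path (@adj K) o t ->
  last o s = last o t -> weight parity o s = weight parity o t ->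
  homotopic (o :: s) (o :: t).
Proof.
apply: (@homotopic_of_normal_form _ _ parity o normal_form).
exact: homotopic_normal_form.
Qed.

End Parity.

(** * The fundamental group of H(d,q) *)

Theorem theorem4p14 (d q : nat) (hd : 1 <= d) (hq : 2 < q) :
  (q = 3 ->
     group_iso (fundamental_group (hamming0 d (ltnW (ltnW hq)))) 'rV[int]_d) /\
  (q <> 3 ->
     group_iso (fundamental_group (hamming0 d (ltnW (ltnW hq)))) 'rV['Z_2]_d).
Proof.
split=> [q3|/eqP q3].
  subst q; apply: (group_iso_hamming crossing_cocycle crossing0) => i;
    have -> : hamming0 d (ltnW (ltnW hq)) i = base3
      by rewrite ffunE; apply: val_inj.
    exact: homotopic_crossing.
  exact: crossing_surj.
have q4 : 3 < q by rewrite ltn_neqAle eq_sym q3.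
apply: (group_iso_hamming (@parity_cocycle q) (@parity0 q)) => i.
  exact: homotopic_parity.
exact: parity_surj.
Qed.
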